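(* For every $\alpha > 0$ and $\varepsilon > 0$ there exists a constant $D = D(\alpha, \varepsilon)$ such that the following holds whenever $\beta := \beta(n) \leq pn/D$ (where $p := p(n)$) and $n$ is sufficiently large. Let $G$ be an $n$-vertex $(p,\beta)$-jumbled graph and let $\psi$ be an edge-colouring of $G$ assigning every edge of $G$ a colour from $[(1 + \alpha) n]$, chosen independently and uniformly at random. Then asymptotically almost surely $G$ contains a path of length $(1 - \varepsilon) n$ which is rainbow under $\psi$.
   Context: An $n$-vertex graph $G$ is $(p,\beta)$-jumbled if $\big|e_G(X,Y) - p|X||Y|\big| \leq \beta \sqrt{|X||Y|}$ holds for all $X, Y \subseteq V(G)$, where $e_G(X,Y)$ is the number of edges with one endpoint in $X$ and the other in $Y$. A path is rainbow under $\psi$ if its edges receive pairwise distinct colours; its length is its number of edges. ''Asymptotically almost surely'' means with probability (over the random colouring) tending to $1$ as $n \to \infty$. *)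

(* Defs.v *)
From mathcomp Require Import all_boot all_order all_algebra.
From mathcomp Require Import boolp classical_sets filter reals topology.
From mathcomp Require Import normedtype sequences.

Set Implicit Arguments.
Unset Strict Implicit.
Unset Printing Implicit Defensive.

Import Order.TTheory GRing.Theory Num.Theory.
Import numFieldNormedType.Exports.

Local Open Scope ring_scope.

(* Since every edge has exactly two elements, [adj] is irreflexive: there are
   no loops. *)
Record sgraph (V : finType) := SGraph {
  edges : {set {set V}};
  edges_card2 : forall e, e \in edges -> #|e| = 2%N
}.

Definition edge (V : finType) (G : sgraph V) := {e : {set V} | e \in edges G}.

Definition adj (V : finType) (G : sgraph V) : rel V :=
  fun x y => [set x; y]%SET \in edges G.

(* Ordered pairs are counted, so an edge with both endpoints in [X :&: Y]
   contributes 2. Counting it once would make [jumbled G p b] impossible for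
   p > 0 and b small compared with p * #|V|. *)
Definition edge_count (V : finType) (G : sgraph V) (X Y : {set V}) : nat :=
  #|[set xy : V * V | [&& xy.1 \in X, xy.2 \in Y & adj G xy.1 xy.2]]|.

Definition jumbled (R : realType) (V : finType) (G : sgraph V) (p b : R) :=
  forall X Y : {set V},
    `|(edge_count G X Y)%:R - p * #|X|%:R * #|Y|%:R|
      <= b * Num.sqrt (#|X|%:R * #|Y|%:R).

Definition coloring (V : finType) (G : sgraph V) (k : nat) :=
  {ffun edge G -> 'I_k}.

(* The path with vertices x :: s, in order; its length is [size s]. *)
Definition is_path (V : finType) (G : sgraph V) (x : V) (s : seq V) : bool :=
  path (adj G) x s && uniq (x :: s).

Definition path_edges (V : finType) (x : V) (s : seq V) : seq {set V} :=
  pairmap (fun u v => [set u; v]%SET) x s.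

Definition rainbow (V : finType) (G : sgraph V) (k : nat)
    (psi : coloring G k) (x : V) (s : seq V) :=
  forall e f : edge G, val e \in path_edges x s -> val f \in path_edges x s ->
    e != f -> psi e != psi f.

Definition has_rainbow_path (R : realType) (V : finType) (G : sgraph V)
    (k : nat) (psi : coloring G k) (l : R) :=
  exists (x : V) (s : seq V),
    [/\ is_path G x s, l <= (size s)%:R & rainbow psi x s].

(* Product over the edges of the uniform distributions on the k colours. *)
Definition coloring_prob (R : realType) (V : finType) (G : sgraph V)
    (k : nat) (A : coloring G k -> Prop) : R :=
  \sum_(psi : coloring G k | `[< A psi >]) \prod_(e : edge G) k%:R^-1.

(* Main.v *)
(* Explore G by depth-first search, revealing the colour of an edge only when
   it is queried and pushing a new vertex only if the stack stays a rainbow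
   path. The vertices split into the stack, the unvisited set U and the finished
   set S; when |S| = |U| every edge between S and U has been queried. If the
   stack is short at that moment, then |S| is linear in n and jumbledness gives
   at least C n queries, with C large because p n is large when D is. Each query
   succeeds with probability bounded below while at most n can succeed, so this
   has exponentially small probability. *)
Require Import Defs.
From mathcomp Require Import all_boot all_order all_algebra.
From mathcomp Require Import boolp classical_sets filter reals topology.
From mathcomp Require Import normedtype sequences.
From mathcomp Require Import zify lra ring.

Set Implicit Arguments.
Unset Strict Implicit.
Unset Printing Implicit Defensive.

Import Order.TTheory GRing.Theory Num.Theory.
Import numFieldNormedType.Exports.

Local Open Scope ring_scope.

(** * Counting colourings with some colours already revealed *)

Definition recolor (E C : finType) (f : {ffun E -> C}) (e : E) (c : C) :
    {ffun E -> C} :=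
  [ffun x => if x == e then c else f x].

(** Divided by [#|C| ^ #|~: X|], the size of this set is the conditional probability of [bad] given
    the colours of [f] on [X]. *)
Definition consistent (E C : finType) (bad : pred {ffun E -> C})
    (X : {set E}) (f : {ffun E -> C}) : {set {ffun E -> C}} :=
  [set g | bad g & [forall e in X, g e == f e]]%SET.

Lemma card_consistent_expose (E C : finType) (bad : pred {ffun E -> C})
    (X : {set E}) (f : {ffun E -> C}) (e : E) : e \notin X ->
  #|consistent bad X f| =
    (\sum_(c : C) #|consistent bad (e |: X)%SET (recolor f e c)|)%N.
Proof.
move=> eX; rewrite -sum1_card.
rewrite (partition_big (fun g : {ffun E -> C} => g e) predT) //=.
apply: eq_bigr => c _; rewrite -sum1_card; apply: eq_bigl => g.
rewrite !inE -andbA; congr (_ && _); apply/andP/forallP.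
  move=> [/forallP gf /eqP gc] x; apply/implyP; rewrite !inE ffunE.
  case: eqP => [-> _|_ /= xX]; first by rewrite gc.
  by have /implyP/(_ xX) := gf x.
move=> gf.
have ge : g e = c.
  by move: (gf e); rewrite !inE ffunE eqxx => /eqP.
split; last by rewrite ge.
apply/forallP => x; apply/implyP => xX; move: (gf x).
rewrite !inE xX orbT ffunE; case: (eqVneq x e) => [xe|//].
by rewrite -xe xX in eX.
Qed.

(** * Edges of the stack and edges between disjoint sets *)

Definition stack_edges (V : finType) (st : seq V) : seq {set V} :=
  if st is x :: s then path_edges x s else [::].

Lemma size_stack_edges (V : finType) (st : seq V) :
  (size (stack_edges st) <= size st)%N.
Proof. by case: st => //= x s; rewrite /path_edges size_pairmap. Qed.

Lemma card_edge_in (V : finType) (G : sgraph V) (r : seq {set V}) :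
  (#|[set e : edge G | val e \in r]%SET| <= size r)%N.
Proof.
rewrite -(card_imset _ val_inj); apply: leq_trans (card_size r).
apply: subset_leq_card; apply/fintype.subsetP => _ /imsetP[e + ->].
by rewrite inE.
Qed.

Lemma adj_sym (V : finType) (G : sgraph V) : symmetric (adj G).
Proof. by move=> x y; rewrite /adj finset.setUC. Qed.

(** Disjointness tells which endpoint of an edge lies in [S], so distinct ordered pairs give
    distinct edges, all of them in [X]. *)
Lemma edge_count_disjoint (V : finType) (G : sgraph V) (S U : {set V})
    (X : {set edge G}) : [disjoint S & U] ->
  (forall (e : edge G) u v, v \in S -> u \in U ->
     val e = [set u; v]%SET -> e \in X) ->
  (edge_count G S U <= #|X|)%N.
Proof.
move=> dSU allX; rewrite /edge_count -(card_imset X val_inj).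
rewrite -(@card_in_imset _ _ (fun xy : V * V => [set xy.1; xy.2]%SET)).
  apply: subset_leq_card; apply/fintype.subsetP => _ /imsetP[[v u] + ->] /=.
  rewrite inE /= => /and3P[vS uU vu]; apply/imsetP.
  exists (Sub [set v; u]%SET vu : edge G); last by rewrite SubK.
  by apply: (allX _ u v) => //; rewrite SubK finset.setUC.
move=> [v u] [v' u']; rewrite !inE /= => /and3P[vS uU _] /and3P[vS' uU' _] eq2.
have neq a b : a \in S -> b \in U -> (a == b) = false.
  by move=> aS bU; apply/eqP => ab; move: (disjointFr dSU aS); rewrite ab bU.
have: v \in [set v'; u']%SET by rewrite -eq2 !inE eqxx.
have: u \in [set v'; u']%SET by rewrite -eq2 !inE eqxx orbT.
rewrite !inE (neq v u') // eq_sym (neq v' u) // orbF /=.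
by move=> /eqP -> /eqP ->.
Qed.

(** * The exploration and its bound on the number of bad colourings *)

Section RainbowDFS.
Variables (R : realFieldType) (V : finType) (G : sgraph V) (K N l : nat).
Variables (th : R) (bad : pred (coloring G K)).
Hypothesis th0 : 0 < th.
Hypothesis th1 : th <= 1.
Hypothesis Kth : (K + #|V|)%:R <= 2 * th * K%:R.
Hypothesis bad_path : forall psi x s,
  is_path G x s -> (l <= size s)%N -> rainbow psi x s -> ~~ bad psi.
Hypothesis many_edges : forall S U : {set V}, [disjoint S & U] ->
  #|S| = #|U| -> (#|V| <= #|S| + #|U| + l)%N -> (N <= edge_count G S U)%N.

(* [st] is the stack (top first), [X] the set of queried edges, [psi] a
   colouring of which only the values on [X] matter, [U] the unvisited set. *)
Record dfs_state (X : {set edge G}) (psi : coloring G K) (st : seq V)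
    (U : {set V}) : Prop := DfsState {
  dfs_uniq : uniq st;
  dfs_fresh : forall v, v \in st -> v \notin U;
  dfs_sorted : sorted (adj G) st;
  dfs_exposed : forall e, val e \in stack_edges st -> e \in X;
  dfs_rainbow : forall e f, val e \in stack_edges st ->
    val f \in stack_edges st -> e != f -> psi e != psi f;
  dfs_finished : forall (e : edge G) u v, u \in U -> v \notin U ->
    v \notin st -> val e = [set u; v]%SET -> e \in X;
  dfs_balance : (#|V| <= size st + #|U|.*2)%N }.

(** A long stack is a rainbow path, so no bad colouring is consistent. With a short stack at least
    [N] edges were queried, and the trivial count [K ^ #|~: X|] suffices. *)
Lemma dfs_terminal X psi st U : dfs_state X psi st U ->
  (size st + #|U|.*2 = #|V|)%N ->
  (#|consistent bad X psi|)%:R * th ^+ #|X|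
    <= K%:R ^+ #|~: X| * th ^+ N * 2 ^+ #|U|.
Proof.
case=> ust fr sst ex rb fin _ bal.
have rhs0 : 0 <= K%:R ^+ #|~: X| * th ^+ N * 2 ^+ #|U| :> R.
  by rewrite !mulr_ge0 ?exprn_ge0 // ltW.
case: (ltnP l (size st)) => [lst|stl].
  (* The inequality [l < size st] is strict because the path has one edge fewer than the stack has
     vertices. *)
  suff -> : consistent bad X psi = finset.set0 by rewrite cards0 mul0r.
  apply/setP => g; rewrite !inE; apply/negP => /andP[bg /forallP gpsi].
  have {}gpsi e : val e \in stack_edges st -> g e = psi e.
    by move=> /ex eX; apply/eqP; move: (gpsi e); rewrite eX.
  case: st ust sst ex rb lst gpsi {bal fr fin} => //= x s.
  move=> ust sst ex rb lst gpsi.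
  have : ~~ bad g.
    apply: (@bad_path _ x s) => //; first by rewrite /is_path sst.
    by move=> e f es fs ef; rewrite !gpsi // rb.
  by rewrite bg.
have cst : #|[set x in st]%SET| = size st by rewrite cardsE; apply/card_uniqP.
have dU : [disjoint U & [set x in st]%SET].
  rewrite disjoint_sym; apply/pred0P => v /=; rewrite inE.
  by case: (boolP (v \in st)) => // /fr /negbTE ->.
pose S := (~: (U :|: [set x in st]))%SET.
have cU : (#|U :|: [set x in st]| = #|U| + size st)%N.
  by rewrite -cst; apply/eqP; rewrite -(leq_card_setU U _).2 in dU *.
have cS : #|S| = #|U|.
  by have := cardsC (U :|: [set x in st])%SET; rewrite -/S cU; lia.
have dSU : [disjoint S & U].
  apply/pred0P => v /=; rewrite !inE; by case: (v \in U); rewrite ?andbF.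
have NX : (N <= #|X|)%N.
  apply: (leq_trans (many_edges dSU cS _)).
    by rewrite cS -bal addnn addnC leq_add2l.
  apply: edge_count_disjoint => // e u v; rewrite !inE negb_or.
  move=> /andP[vU vst] uU.
  exact: fin.
(* A colouring that agrees with [psi] on [X] is determined by its restriction to the complement. *)
have card_le : (#|consistent bad X psi| <= K ^ #|~: X|)%N.
  pose F (g : coloring G K) : {ffun {e | e \in (~: X)%SET} -> 'I_K} :=
    [ffun e => g (val e)].
  have -> : (K ^ #|~: X| = #|{: {ffun {e | e \in (~: X)%SET} -> 'I_K}}|)%N.
    by rewrite card_ffun card_ord card_sig.
  rewrite -(@card_in_imset _ _ F) ?max_card // => g h.
  rewrite !inE => /andP[_ /forallP gp] /andP[_ /forallP hp] FE.
  apply/ffunP => e; case: (boolP (e \in X)) => eX.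
    by move: (gp e) (hp e); rewrite eX => /eqP -> /eqP ->.
  have eX' : e \in (~: X)%SET by rewrite inE.
  by move/ffunP/(_ (Sub e eX')): FE; rewrite !ffunE SubK.
have thN : th ^+ #|X| <= th ^+ N by apply: ler_wiXn2l => //; exact: ltW.
have : 1 <= 2 ^+ #|U| :> R by rewrite exprn_ege1 // ler1n.
move=> two; apply: le_trans (_ : K%:R ^+ #|~: X| * th ^+ N <= _).
  apply: ler_pM => //; first by rewrite exprn_ge0 // ltW.
  by rewrite -natrX ler_nat.
by rewrite ler_peMr // mulr_ge0 ?exprn_ge0 // ltW.
Qed.

(* Conditionally on the revealed colours, the bad event has probability at most
   th ^ (N - #|X|) * 2 ^ #|U|: a query multiplies this by 1 / th, a success also
   halves it, and [Kth] says that the average does not increase. *)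
Lemma dfs_bound m X psi st U : dfs_state X psi st U ->
  (#|U|.*2 + size st + #|~: X| <= m)%N ->
  (#|consistent bad X psi|)%:R * th ^+ #|X|
    <= K%:R ^+ #|~: X| * th ^+ N * 2 ^+ #|U|.
Proof.
(* The measure drops at every step: a push moves a vertex from weight 2 to weight 1, a pop removes
   weight 1, and a failed query shrinks [~: X]. *)
elim: m X psi st U => [|m IH] X psi st U ok.
  move=> mle; have bal := dfs_balance ok; apply: (dfs_terminal ok); lia.
move=> mle.
case: (eqVneq (size st + #|U|.*2)%N #|V|) => [/(dfs_terminal ok)//|neq].
(* Each step lowers [size st + #|U|.*2] by at most one, so strictness here keeps [dfs_balance] true
   afterwards and equality is never jumped over. *)
have bal : (#|V| < size st + #|U|.*2)%N.
  by rewrite ltn_neqAle eq_sym neq (dfs_balance ok).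
case: st ok neq bal mle => [|x s] ok _ bal mle.
  have /card_gt0P[u uU] : (0 < #|U|)%N by case: #|U| bal.
  have cU : #|U| = #|U :\ u|.+1 by rewrite (cardsD1 u U) uU.
  apply: le_trans (IH X psi [:: u] (U :\ u)%SET _ _) _.
  - case: ok => _ _ _ ex rb fin _; split => //.
    + by move=> v; rewrite !inE => /eqP ->; rewrite eqxx.
    + move=> e w v; rewrite !inE => /andP[_ wU].
      by case: (eqVneq v u) => //= _ vU _; apply: fin.
    + by move: bal => /=; lia.
  - by move: mle => /=; lia.
  rewrite ler_wpM2l ?mulr_ge0 ?exprn_ge0 ?(ltW th0) //.
  by rewrite ler_weXn2l ?ler1n // cU.
(* Either some edge from the top [x] to [U] is still unqueried, or [x] is finished and gets
   popped. *)
case: (boolP [exists u in U, [exists e : edge G,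
    (val e == [set u; x]%SET) && (e \notin X)]]); last first.
  move=> /exists_inPn none; apply: (IH _ _ s U).
  - case: ok => /= /andP[xs us] fr srt ex rb fin _.
    have sub e : e \in stack_edges s -> e \in path_edges x s.
      by case: (s) => //= y s' ?; rewrite inE; apply/orP; right.
    split => //.
    + by move=> v vs; apply: fr; rewrite inE vs orbT.
    + exact: path_sorted srt.
    + by move=> e /sub; apply: ex.
    + by move=> e f /sub ? /sub; apply: rb.
    + move=> e u v uU vU vs ev; case: (eqVneq v x) => [vx|vx].
        have /existsPn/(_ e) := none u uU.
        by rewrite ev vx eqxx /= negbK.
      by apply: fin ev => //; rewrite inE negb_or vx.
  - by move: mle => /=; lia.
move=> /exists_inP[u uU /existsP[e /andP[/eqP ee eX]]].
have cU : #|U| = #|U :\ u|.+1 by rewrite (cardsD1 u U) uU.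
have cX : #|e |: X| = #|X|.+1 by rewrite cardsU1 eX.
have cXC : #|~: X| = #|~: (e |: X)|.+1.
  rewrite (cardsD1 e (~: X)%SET) finset.in_setC eX; congr (_.+1).
  by apply: eq_card => f; rewrite !inE negb_or.
case: (ok) => /= /andP[xs us] fr srt ex rb fin _.
have eNs f : val f \in path_edges x s -> f != e.
  by move=> /ex fX; apply: contraNneq eX => <-.
have old c f : val f \in path_edges x s -> recolor psi e c f = psi f.
  by move=> /eNs /negbTE fe; rewrite ffunE fe.
(* [B] holds the colours on the stack: a query fails when its colour lies in [B], and otherwise
   extends the rainbow path. *)
pose B := (psi @: [set f : edge G | val f \in path_edges x s])%SET.
have BV : (#|B| <= #|V|)%N.
  apply: leq_trans (leq_imset_card _ _) _.
  apply: leq_trans (card_edge_in _ _) _.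
  apply: leq_trans (size_stack_edges (x :: s)) _.
  by rewrite -(card_uniqP _) ?max_card //=; apply/andP.
have bfail c :
    (#|consistent bad (e |: X)%SET (recolor psi e c)|)%:R * th ^+ #|X|.+1
    <= K%:R ^+ #|~: (e |: X)| * th ^+ N * 2 ^+ #|U|.
  rewrite -cX; apply: (IH _ _ (x :: s)) => /=.
    split => //=.
    + by rewrite xs.
    + by move=> f /ex fX; rewrite !inE fX orbT.
    + by move=> f g fs gs fg; rewrite !old ?rb.
    + by move=> f w v wU vU vs fE; rewrite !inE (fin _ _ _ wU vU vs fE) orbT.
    + exact: dfs_balance ok.
  by move: mle; rewrite cXC /= addnS ltnS.
have bsucc c : c \notin B ->
    (#|consistent bad (e |: X)%SET (recolor psi e c)|)%:R * th ^+ #|X|.+1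
    <= K%:R ^+ #|~: (e |: X)| * th ^+ N * 2 ^+ #|U :\ u|.
  move=> cB; rewrite -cX; apply: (IH _ _ [:: u, x & s]) => /=.
    have new f : val f \in path_edges x s -> c != psi f.
      by move=> fs; apply: contraNneq cB => ->; apply: imset_f; rewrite inE.
    have ce : recolor psi e c e = c by rewrite ffunE eqxx.
    split => //=.
    + rewrite xs us !andbT; apply/negP => /fr; by rewrite uU.
    + move=> v; rewrite inE => /orP[/eqP ->|/fr vU]; first by rewrite !inE eqxx.
      by rewrite !inE (negbTE vU) andbF.
    + by rewrite srt andbT /adj -ee (valP e).
    + move=> f; rewrite inE -ee => /orP[/eqP/val_inj ->|/ex fX].
        by rewrite !inE eqxx.
      by rewrite !inE fX orbT.
    + move=> f g; rewrite !inE -ee.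
      move=> /orP[/eqP/val_inj ->|fs] /orP[/eqP/val_inj ->|gs].
      * by rewrite eqxx.
      * by rewrite ce (old c g) // => _; apply: new.
      * by rewrite ce (old c f) // => _; rewrite eq_sym; apply: new.
      * by rewrite !old //; apply: rb.
    + move=> f w v; rewrite !inE => /andP[_ wU].
      case: (eqVneq v u) => //= vu vU vs fE.
      by rewrite (fin f w v) ?orbT // inE.
    + by move: bal; rewrite cU doubleS /= !addSn !addnS ltnS.
  by move: mle; rewrite cXC cU /= !addnS doubleS !addSn !ltnS => /ltnW.
rewrite (card_consistent_expose _ _ eX) natr_sum.
rewrite -(ler_pM2r th0) -[leLHS]mulrA -exprSr mulr_suml.
(* A success is bounded by [Q] and a failure by [2 * Q], since only a success shrinks [U]. The sum
   over colours is [Q * (K + #|B|)], which [Kth] controls. *)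
set Q := K%:R ^+ #|~: (e |: X)| * th ^+ N * 2 ^+ #|U :\ u|.
have Q0 : 0 <= Q by rewrite !mulr_ge0 ?exprn_ge0 // ltW.
rewrite (bigID (mem B)) /=.
apply: (@le_trans _ _ (\sum_(c in B) (Q * 2) + \sum_(c | c \notin B) Q)).
  apply: lerD; apply: ler_sum => c cB; last exact: bsucc.
  by rewrite /Q -mulrA -exprSr -cU.
rewrite !sumr_const.
have cB : (#|[predC B]| = K - #|B|)%N.
  by rewrite -(addKn #|B| #|[predC B]|) cardC card_ord.
have BK : (#|B| <= K)%N by rewrite -[K in leqRHS]card_ord max_card.
rewrite -[X in _ + _ *+ X]/#|[predC B]| cB.
rewrite -(mulr_natr (Q * 2)) -(mulr_natr Q) natrB //.
have -> : Q * 2 * #|B|%:R + Q * (K%:R - #|B|%:R) = Q * (K%:R + #|B|%:R) by ring.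
have -> : K%:R ^+ #|~: X| * th ^+ N * 2 ^+ #|U| * th = Q * (2 * th * K%:R).
  have regroup (a b c k : R) :
      a * k * b * (c * 2) * th = a * b * c * (2 * th * k).
    by ring.
  by rewrite cXC cU !exprSr regroup.
rewrite ler_wpM2l //; apply: le_trans Kth.
by rewrite -natrD ler_nat leq_add2l.
Qed.

Lemma card_bad_le : (#|[set psi | bad psi]%SET|)%:R
  <= K%:R ^+ #|{: edge G}| * th ^+ N * 2 ^+ #|V|.
Proof.
(* The bad [psi] serves only as the placeholder colouring of the initial state, where nothing is
   revealed. *)
case: (pickP (fun psi => bad psi)) => [psi _|none]; last first.
  rewrite (_ : [set psi | bad psi]%SET = finset.set0); last first.
    by apply/setP => psi; rewrite !inE none.
  by rewrite cards0 !mulr_ge0 ?exprn_ge0 // ltW.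
have := @dfs_bound _ finset.set0 psi [::] finset.setT _ (leqnn _).
rewrite cards0 expr0 mulr1 finset.setC0 !cardsT.
suff -> : consistent bad finset.set0 psi = [set psi | bad psi]%SET.
  apply; split => //.
  - by move=> e u v _; rewrite inE.
  - by rewrite cardsT /=; lia.
apply/setP => g; rewrite !inE.
rewrite [X in _ && X](_ : _ = true) ?andbT //.
by apply/forallP => e; rewrite inE.
Qed.

End RainbowDFS.

(** * Degrees and edge counts in jumbled graphs *)

Definition neighbors (V : finType) (G : sgraph V) (v : V) : {set V} :=
  [set w | adj G v w]%SET.

Lemma edge_count_neighbors (V : finType) (G : sgraph V) (v : V) :
  edge_count G [set v]%SET (neighbors G v) = #|neighbors G v|.
Proof.
have pair_inj : injective (pair v : V -> V * V) by move=> x y [].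
rewrite /edge_count -(card_imset (neighbors G v) pair_inj).
apply: eq_card => -[x y]; rewrite !inE /=; apply/and3P/imsetP.
  by move=> [/eqP -> vy _]; exists y; rewrite // inE.
by move=> [w]; rewrite inE => vw [-> ->]; rewrite eqxx vw.
Qed.

Lemma edge_count_setT (V : finType) (G : sgraph V) :
  edge_count G finset.setT finset.setT = (\sum_v #|neighbors G v|)%N.
Proof.
under eq_bigr do rewrite -edge_count_neighbors.
rewrite /edge_count -sum1_card.
rewrite (partition_big (fun xy : V * V => xy.1) predT) //=.
apply: eq_bigr => v _; rewrite -sum1_card; apply: eq_bigl => -[x y].
by rewrite !inE /=; case: eqP => [->|]; rewrite ?andbF //= andbT andbb.
Qed.

(** Jumbledness of the pair of full vertex sets bounds the degree sum below by [p n^2 - b n], at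
    least [p n^2 / 2] as [2 <= D]; then average. *)
Lemma jumbled_large_degree (R : realType) (V : finType) (G : sgraph V)
    (p b D : R) : 0 < p -> 2 <= D ->
  b <= p * #|V|%:R / D -> jumbled G p b -> (0 < #|V|)%N ->
  exists v, p * #|V|%:R / 2 <= #|neighbors G v|%:R.
Proof.
move=> p0 D2 bD jG V0; apply: contrapT => /forallNP small.
have n0 : 0 < #|V|%:R :> R by rewrite ltr0n.
have D0 : 0 < D by lra.
have := jG finset.setT finset.setT.
rewrite -expr2 sqrtr_sqr cardsT (ger0_norm (ler0n _ _)).
rewrite edge_count_setT natr_sum ler_norml => /andP[+ _].
apply/negP; rewrite -ltNge.
have lt_sum : \sum_v #|neighbors G v|%:R < \sum_(v : V) p * #|V|%:R / 2.
  have /card_gt0P[v0 _] := V0.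
  apply: ltr_sum; first by apply/hasP; exists v0; rewrite ?mem_index_enum.
  by move=> v _; rewrite ltNge; apply/negP/small.
move: lt_sum; rewrite sumr_const -mulr_natr => lt_sum.
have bn : b * #|V|%:R <= p * #|V|%:R / 2 * #|V|%:R.
  rewrite ler_wpM2r ?ler0n //; apply: (le_trans bD).
  by rewrite ler_wpM2l ?(mulr_ge0 (ltW p0) (ltW n0)) // lef_pV2 ?posrE.
lra.
Qed.

(* Test jumbledness on ({v}, N(v)): for p <= 1/2 it gives deg v <= (2 b)^2. *)
Lemma jumbled_average_degree (R : realType) (V : finType) (G : sgraph V)
    (p b D : R) : 0 < p -> 2 <= D ->
  b <= p * #|V|%:R / D -> jumbled G p b -> (0 < #|V|)%N -> p <= 1 / 2 ->
  D ^+ 2 / 8 <= p * #|V|%:R.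
Proof.
move=> p0 D2 bD jG V0 p2; have [v dv] := jumbled_large_degree p0 D2 bD jG V0.
have n0 : 0 < #|V|%:R :> R by rewrite ltr0n.
have := jG [set v]%SET (neighbors G v).
rewrite edge_count_neighbors cards1 mulr1 mul1r ler_norml => /andP[_].
set q := p * #|V|%:R in bD dv *.
have q0 : 0 < q by rewrite mulr_gt0.
have dge0 : 0 <= #|neighbors G v|%:R :> R by rewrite ler0n.
set r := Num.sqrt _.
have r0 : 0 < r by rewrite sqrtr_gt0; move: dv; lra.
have dr : #|neighbors G v|%:R = r ^+ 2 by rewrite sqr_sqrtr.
rewrite dr in dv *.
move=> rb.
have D0 : 0 < D by lra.
(* With [r ^+ 2] the degree, jumbledness gives [r ^+ 2 <= p * r ^+ 2 + b * r], and [p <= 1 / 2]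
   absorbs half of the left side. *)
have rq : r <= 2 * (q / D).
  have : r * (r / 2) <= r * (q / D).
    have : p * r ^+ 2 <= 1 / 2 * r ^+ 2 by rewrite ler_wpM2r // sqr_ge0.
    have : b * r <= q / D * r by rewrite ler_wpM2r // ltW.
    by move: rb; rewrite expr2; lra.
  by rewrite ler_pM2l // ler_pdivrMr // mulrC.
have : r ^+ 2 <= (2 * (q / D)) ^+ 2.
  by rewrite ler_sqr ?nnegrE ?mulr_ge0 ?invr_ge0 // ltW.
move=> /(le_trans dv).
rewrite (_ : (2 * (q / D)) ^+ 2 = q * (4 * q / D ^+ 2)); last by field; lra.
rewrite ler_pM2l // ler_pdivlMr ?exprn_gt0 //; lra.
Qed.

Lemma jumbled_edge_count (R : realType) (V : finType) (G : sgraph V)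
    (p b D : R) (S U : {set V}) :
  b <= p * #|V|%:R / D -> jumbled G p b -> #|S| = #|U| ->
  #|U|%:R * (p * #|U|%:R - p * #|V|%:R / D) <= (edge_count G S U)%:R.
Proof.
move=> bD jG SU; have := jG S U; rewrite SU -expr2 sqrtr_sqr.
rewrite (ger0_norm (ler0n _ _)).
rewrite ler_norml => /andP[+ _].
have : b * #|U|%:R <= p * #|V|%:R / D * #|U|%:R by rewrite ler_wpM2r ?ler0n.
lra.
Qed.

(** * From counting to probability *)

Lemma coloring_prob_compl (R : realType) (V : finType) (G : sgraph V) (k : nat)
    (A : coloring G k -> Prop) : (0 < k)%N ->
  coloring_prob R A =
    1 - #|[set psi | ~~ `[< A psi >]]%SET|%:R / k%:R ^+ #|{: edge G}|.
Proof.
move=> k0; rewrite /coloring_prob.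
have k1 : k%:R ^+ #|{: edge G}| != 0 :> R.
  by rewrite expf_neq0 // pnatr_eq0 -lt0n.
under eq_bigr do rewrite prodr_const exprVn.
rewrite sumr_const -[LHS]mulr_natl.
have : (#|[pred psi | `[< A psi >]]| + #|[set psi | ~~ `[< A psi >]]%SET|
    = k ^ #|{: edge G}|)%N.
  rewrite -[k in RHS]card_ord -card_ffun -(cardC [pred psi | `[< A psi >]]).
  by congr addn; apply: eq_card => psi; rewrite !inE.
move=> /(congr1 (fun m => m%:R : R)); rewrite natrD natrX => E.
have -> : #|(fun psi : coloring G k => `[< A psi >])|%:R =
    k%:R ^+ #|{: edge G}| - #|[set psi | ~~ `[< A psi >]]%SET|%:R :> R.
  by rewrite -E addrK.
by rewrite mulrBl divff.
Qed.

(* [th] is the per-query decay rate of the failure bound: a query fails with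
   probability at most f = 1 / (1 + alpha / 2), and th = f + (1 - f) / 2. *)
Lemma rainbow_path_prob_ge (R : realType) (n C : nat) (alpha eps D p b : R)
    (G : sgraph 'I_n) (th := (1 + (1 + alpha / 2)^-1) / 2) :
  0 < alpha -> 0 < eps -> eps <= 1 -> 2 <= D -> 8 / eps <= D ->
  256 * C%:R / eps ^+ 2 <= D -> th ^+ C <= 1 / 4 ->
  2 / alpha <= n%:R -> 2 / eps <= n%:R -> 64 * C%:R / eps ^+ 2 <= n%:R ->
  0 < p -> b <= p * n%:R / D -> jumbled G p b ->
  1 - (1 / 2) ^+ n <= coloring_prob R
    (fun psi : coloring G (Num.truncn ((1 + alpha) * n%:R)) =>
       has_rainbow_path psi ((1 - eps) * n%:R)).
Proof.
move=> a0 e0 e1 D2 De DC thC na ne nC p0 bD jG.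
have n0 : 0 < n%:R :> R by apply: lt_le_trans na; rewrite divr_gt0.
set K := Num.truncn _.
(* Truncation loses less than 1, which [alpha / 2 * n] covers. *)
have Kn : (1 + alpha / 2) * n%:R <= K%:R.
  have := truncnS_gt ((1 + alpha) * n%:R); rewrite -/K -natr1.
  by move: na; rewrite ler_pdivrMr //; lra.
have K0 : 0 < K%:R :> R by apply: lt_le_trans Kn; rewrite mulr_gt0 //; lra.
have f0 : 0 < 1 + alpha / 2 by lra.
have th0 : 0 < th by rewrite divr_gt0 // addr_gt0 ?invr_gt0.
have th1 : th <= 1.
  rewrite /th; have : (1 + alpha / 2)^-1 <= 1 by rewrite invf_le1 //; lra.
  lra.
have Kth : (K + #|'I_n|)%:R <= 2 * th * K%:R.
  have : n%:R <= K%:R / (1 + alpha / 2) by rewrite ler_pdivlMr // mulrC.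
  by rewrite card_ord natrD /th; lra.
(* The successor makes [l] at least [(1 - eps) * n] even when that is not an integer. *)
pose l := (Num.truncn ((1 - eps) * n%:R)).+1.
have ln : (1 - eps) * n%:R <= l%:R by rewrite ltW // truncnS_gt.
have nl : l%:R <= (1 - eps) * n%:R + 1.
  by rewrite /l -natr1 lerD2r truncn_le mulr_ge0 ?(ltW n0) // subr_ge0.
(* For [p > 1 / 2] the lower bound on [n] suffices; otherwise the average degree is at least
   [D ^+ 2 / 8 >= D / 8]. *)
have pn : 32 * C%:R / eps ^+ 2 <= p * n%:R.
  case: (leP p (1 / 2)) => p2; last first.
    have : 1 / 2 * n%:R <= p * n%:R by rewrite ler_wpM2r // ltW.
    by move: nC; lra.
  have bD' : b <= p * #|'I_n|%:R / D by rewrite card_ord.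
  have V0 : (0 < #|'I_n|)%N by rewrite card_ord -(ltr_nat R).
  have := jumbled_average_degree p0 D2 bD' jG V0 p2; rewrite card_ord.
  have : D <= D ^+ 2 by rewrite expr2 ler_peMr //; lra.
  by move: DC; lra.
rewrite coloring_prob_compl -?(ltr_nat R) // lerD2l lerN2.
rewrite ler_pdivrMr ?exprn_gt0 //.
pose P (psi : coloring G K) := has_rainbow_path psi ((1 - eps) * n%:R).
have bad_path psi x s : is_path G x s -> (l <= size s)%N -> rainbow psi x s ->
    ~~ ~~ `[< P psi >].
  move=> xs ls rb; rewrite negbK; apply/asboolP; exists x, s; split => //.
  by apply: (le_trans ln); rewrite ler_nat.
have many_edges (S U : {set 'I_n}) : [disjoint S & U] -> #|S| = #|U| ->
    (#|'I_n| <= #|S| + #|U| + l)%N -> (C * n <= edge_count G S U)%N.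
  move=> _ SU; rewrite SU card_ord -(ler_nat R) !natrD -(ler_nat R) natrM => nU.
  have bD' : b <= p * #|'I_n|%:R / D by rewrite card_ord.
  apply: le_trans (jumbled_edge_count bD' jG SU); rewrite card_ord.
  (* Here [2 * #|U| >= n - l >= eps * n - 1], and [eps * n >= 2] absorbs the 1. *)
  have Un : eps * n%:R / 4 <= #|U|%:R.
    by move: ne; rewrite ler_pdivrMr //; lra.
  have D8 : p * n%:R / D <= p * n%:R * (eps / 8).
    rewrite ler_wpM2l ?(mulr_ge0 (ltW p0) (ltW n0)) //.
    rewrite -[eps / 8]invrK lef_pV2 ?posrE ?invr_gt0 ?divr_gt0 //; last lra.
    by rewrite invf_div.
  have pU : p * (eps * n%:R / 4) <= p * #|U|%:R by rewrite ler_wpM2l // ltW.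
  apply: (@le_trans _ _ (eps * n%:R / 4 * (p * n%:R * (eps / 8)))).
    rewrite (_ : eps * n%:R / 4 * _ = p * n%:R * (eps ^+ 2 / 32) * n%:R);
      last by field.
    rewrite ler_wpM2r ?ler0n //.
    move: pn; rewrite ler_pdivrMr ?exprn_gt0 //; lra.
  apply: ler_pM => //; last lra.
    by rewrite divr_ge0 // mulr_ge0 // ltW.
  exact: mulr_ge0 (mulr_ge0 (ltW p0) (ltW n0)) (divr_ge0 (ltW e0) (ler0n _ _)).
have := card_bad_le th0 th1 Kth bad_path many_edges.
move=> /le_trans; apply; rewrite -mulrA mulrC ler_wpM2r ?exprn_ge0 //.
(* With [N = C * n] the failure bound is [(th ^+ C * 2) ^+ n], and [th ^+ C <= 1 / 4]. *)
rewrite card_ord exprM -exprMn lerXn2r ?nnegrE //.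
- by rewrite mulr_ge0 // exprn_ge0 // ltW.
- lra.
- lra.
Qed.

(** * Choice of the constants and passage to the limit *)

Local Open Scope classical_set_scope.

Theorem theorem2p2 (R : realType) (alpha eps : R) :
  0 < alpha -> 0 < eps ->
  exists D : R, 0 < D /\
    forall (p beta : nat -> R) (G : forall n : nat, sgraph 'I_n),
      (\forall n \near \oo, 0 < p n) ->
      (\forall n \near \oo, beta n <= p n * n%:R / D) ->
      (\forall n \near \oo, jumbled (G n) (p n) (beta n)) ->
      (fun n : nat =>
         coloring_prob R
           (fun psi : coloring (G n) (Num.truncn ((1 + alpha) * n%:R)) =>
              has_rainbow_path psi ((1 - eps) * n%:R))) @ \oo --> (1 : R).
Proof.
move=> a0 e0; pose th : R := (1 + (1 + alpha / 2)^-1) / 2.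
have f0 : 0 < 1 + alpha / 2 by lra.
have th0 : 0 < th by rewrite divr_gt0 // addr_gt0 ?invr_gt0.
have th1 : th < 1.
  rewrite /th; have : (1 + alpha / 2)^-1 < 1 by rewrite invf_lt1 //; lra.
  lra.
have [C thC] : exists C, th ^+ C <= 1 / 4.
  have /cvgrPdist_le : GRing.exp th @ \oo --> (0 : R).
    by apply: cvg_expr; rewrite gtr0_norm.
  move=> /(_ (1 / 4)) [|C _ /(_ C (leqnn C)) /=]; first by lra.
  by rewrite sub0r normrN gtr0_norm ?exprn_gt0 // => ?; exists C.
(* Capping [eps] at 1 only asks for a longer path, and keeps [(1 - e) * n] nonnegative. *)
pose e := Num.min eps 1.
have ee : e <= eps by rewrite ge_min lexx.
have e1 : e <= 1 by rewrite ge_min lexx orbT.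
have e_gt0 : 0 < e by rewrite lt_min e0 ltr01.
have De : 0 <= 8 / e by rewrite divr_ge0 ?ltW.
have DC : 0 <= 256 * C%:R / e ^+ 2.
  by rewrite divr_ge0 ?mulr_ge0 ?ler0n ?(ltW e_gt0).
(* The sum of nonnegative terms dominates each of the three lower bounds required of [D]. *)
exists (2 + 8 / e + 256 * C%:R / e ^+ 2); split; first by lra.
move=> p b G p0 bD jG.
apply: (@squeeze_cvgr _ _ _ _ (fun n => 1 - (1 / 2) ^+ n) (fun=> 1)).
- near=> n.
  have K0 : (0 < Num.truncn ((1 + alpha) * n%:R))%N.
    rewrite truncn_gt0; apply: (@le_trans _ _ n%:R).
      by near: n; exact: nbhs_infty_ger.
    by rewrite ler_peMl //; lra.
  apply/andP; split; last first.
    by rewrite coloring_prob_compl // gerBl divr_ge0 ?exprn_ge0.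
  apply: (@le_trans _ _ (coloring_prob R
    (fun psi : coloring (G n) (Num.truncn ((1 + alpha) * n%:R)) =>
       has_rainbow_path psi ((1 - e) * n%:R)))).
    apply: (@rainbow_path_prob_ge _ _ C _ _
      (2 + 8 / e + 256 * C%:R / e ^+ 2) (p n) (b n)) => //; try lra.
    + by near: n; exact: nbhs_infty_ger.
    + by near: n; exact: nbhs_infty_ger.
    + by near: n; exact: nbhs_infty_ger.
    + by near: n.
    + by near: n.
    + by near: n.
  rewrite !coloring_prob_compl // lerD2l lerN2.
  rewrite ler_wpM2r ?invr_ge0 ?exprn_ge0 //.
  rewrite ler_nat; apply: subset_leq_card; apply/fintype.subsetP => psi.
  rewrite !inE; apply: contra => /asboolP[x [s [xs ls rb]]].
  apply/asboolP; exists x, s; split => //; apply: le_trans ls.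
  by rewrite ler_wpM2r // lerB.
- rewrite -[X in _ --> X]subr0; apply: cvgB; first exact: cvg_cst.
  by apply: cvg_expr; rewrite gtr0_norm; lra.
- exact: cvg_cst.
Unshelve. all: by end_near.
Qed.
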